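(* Let $\mathcal{B}$ be a swap structure for $\mathbf{Ci}$. Then there exist a set $I$ and a monomorphism of multialgebras $\hat h:\mathcal{B}\to\prod_{i\in I}\mathcal{B}_{\mathbb{A}_2}^{\mathbf{Ci}}$.
   Context: Let $\Sigma=\{\wedge,\vee,\to,\neg,\circ\}$, with $\wedge,\vee,\to$ binary and $\neg,\circ$ unary. A multialgebra over $\Sigma$ is a nonempty set $B$ with, for each $n$-ary symbol $c$, a function $c^{\mathcal{B}}:B^n\to\wp(B)\setminus\{\emptyset\}$. A homomorphism $f:\mathcal{A}\to\mathcal{B}$ is a function between the domains with $f[c^{\mathcal{A}}(\vec a)]\subseteq c^{\mathcal{B}}(f(\vec a))$ for all $c$ and $\vec a$. These form the category $\mathbf{MAlg}(\Sigma)$; a monomorphism of multialgebras is a monomorphism in this category. The product $\prod_{i\in I}\mathcal{A}_i$ has as domain the cartesian product of the domains and multioperations $c(\vec a)=\prod_{i\in I}c^{\mathcal{A}_i}(\pi_i(\vec a))$ (for $I=\emptyset$ it is the one-element multialgebra). For a Boolean algebra $\mathcal{A}$ with domain $A$ (the one-element Boolean algebra is allowed) and $z\in A^3$ write $z=(z_1,z_2,z_3)$; $\sim$ is Boolean complement. Put $\mathrm{B}_{\mathcal{A}}^{\mathbf{ciw}}=\{z\in A^3 : z_1\vee z_2=1 \text{ and } z_3={\sim}(z_1\wedge z_2)\}$. A swap structure for $\mathbf{Ci}$ over $\mathcal{A}$ is a multialgebra $\mathcal{B}$ over $\Sigma$ with domain $B\subseteq \mathrm{B}_{\mathcal{A}}^{\mathbf{ciw}}$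 such that $0\in\{z_1: z\in B\}$ and for all $z,w\in B$: (i) $\emptyset\ne z\#w\subseteq\{u\in B: u_1=z_1\# w_1\}$ for $\#\in\{\wedge,\vee,\to\}$; (ii) $\emptyset\neq\neg z\subseteq\{u\in B:u_1=z_2 \text{ and } u_2\le z_1\}$; (iii) $\circ z=\{({\sim}(z_1\wedge z_2),z_1\wedge z_2,1)\}$. A swap structure for $\mathbf{Ci}$ is one over some Boolean algebra. The full swap structure $\mathcal{B}_{\mathcal{A}}^{\mathbf{Ci}}$ has domain $\mathrm{B}_{\mathcal{A}}^{\mathbf{ciw}}$ and equality in the right-hand inclusions of (i)–(ii), with (iii) unchanged. $\mathbb{A}_2$ is the two-element Boolean algebra. *)

(* Defs.v *)
From mathcomp Require Import all_boot all_order.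
From mathcomp Require Import boolp classical_sets.

Set Implicit Arguments.
Unset Strict Implicit.
Unset Printing Implicit Defensive.

Import Order.Theory.

Local Open Scope classical_set_scope.

Variant connective := And | Or | Imp | Neg | Circ.

Definition arity (c : connective) : nat :=
  match c with And | Or | Imp => 2 | Neg | Circ => 1 end.

(* Multialgebras over the signature above, with domain T. *)
Record multialgebra (T : Type) := Multialgebra {
  mop :> forall c : connective, (arity c).-tuple T -> set T;
  mdom_nonempty : [set: T] !=set0;
  mop_nonempty : forall c (a : (arity c).-tuple T), mop a !=set0 }.

Definition is_hom (T U : Type) (A : multialgebra T) (B : multialgebra U)
    (f : T -> U) : Prop :=
  forall c (a : (arity c).-tuple T), f @` A c a `<=` B c (map_tuple f a).

(* Categorical monomorphism; injectivity is not part of the definition. *)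
Definition is_mono (T U : Type) (A : multialgebra T) (B : multialgebra U)
    (f : T -> U) : Prop :=
  is_hom A B f /\
  forall (V : Type) (C : multialgebra V) (g1 g2 : V -> T),
    is_hom C A g1 -> is_hom C A g2 -> f \o g1 = f \o g2 -> g1 = g2.

Section Product.
Variables (I : Type) (T : I -> Type) (A : forall i, multialgebra (T i)).

Definition prod_op c (a : (arity c).-tuple (forall i, T i)) :
    set (forall i, T i) :=
  [set u | forall i, A i c (map_tuple (fun x => x i) a) (u i)].

Fact prod_dom_nonempty : [set: forall i, T i] !=set0.
Proof. by exists (fun i => projT1 (cid (mdom_nonempty (A i)))). Qed.

Fact prod_op_nonempty c (a : (arity c).-tuple (forall i, T i)) :
  prod_op a !=set0.
Proof.
exists (fun i => projT1 (cid (mop_nonempty (A i) (map_tuple (fun x => x i) a)))).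
by move=> i; case: cid.
Qed.

Definition prod_malg : multialgebra (forall i, T i) :=
  Multialgebra prod_dom_nonempty prod_op_nonempty.
End Product.

(* Boolean algebras are MathComp's complemented distributive lattices with
   bottom and top, for which \bot = \top is allowed. *)
Section Swap.
Variables (d : Order.disp_t) (A : ctbDistrLatticeType d).

Definition c1 (z : A * A * A) : A := z.1.1.
Definition c2 (z : A * A * A) : A := z.1.2.
Definition c3 (z : A * A * A) : A := z.2.

Definition bimp (x y : A) : A := (~` x `|` y)%O.

Definition Bciw : set (A * A * A) :=
  [set z | (c1 z `|` c2 z)%O = \top%O /\ c3 z = (~` (c1 z `&` c2 z))%O].

(* The right-hand sides of the conditions on the multioperations, as subsets
   of A^3. *)
Definition Ci_rhs (c : connective) : (arity c).-tuple (A * A * A) ->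
    set (A * A * A) :=
  match c return (arity c).-tuple (A * A * A) -> set (A * A * A) with
  | And => fun a =>
      [set u | c1 u = (c1 (tnth a ord0) `&` c1 (tnth a ord_max))%O]
  | Or => fun a =>
      [set u | c1 u = (c1 (tnth a ord0) `|` c1 (tnth a ord_max))%O]
  | Imp => fun a =>
      [set u | c1 u = bimp (c1 (tnth a ord0)) (c1 (tnth a ord_max))]
  | Neg => fun a => let z := tnth a ord0 in
      [set u | c1 u = c2 z /\ (c2 u <= c1 z)%O]
  | Circ => fun a => let z := tnth a ord0 in
      [set ((~` (c1 z `&` c2 z))%O, (c1 z `&` c2 z)%O, \top%O)]
  end.

Definition Ci_rhs_in (D : set (A * A * A)) c (a : (arity c).-tuple D) : set D :=
  [set u | Ci_rhs (map_tuple val a) (val u)].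

(* Nonemptiness of the multioperations is part of [multialgebra]. *)
Definition is_swap_Ci (D : set (A * A * A)) (B : multialgebra D) : Prop :=
  [/\ D `<=` Bciw,
      [set c1 z | z in D] \bot%O,
      forall c (a : (arity c).-tuple D), c <> Circ -> B c a `<=` Ci_rhs_in a
    & forall a : 1.-tuple D, B Circ a = @Ci_rhs_in D Circ a].

Lemma Bciw_bot : Bciw (\bot, \top, \top)%O.
Proof. by rewrite /Bciw /c1 /c2 /c3 /= joinx1 meet0x compl0. Qed.

Fact full_dom_nonempty : [set: Bciw] !=set0.
Proof. by exists (SigSub (mem_set Bciw_bot)). Qed.

Fact full_op_nonempty c (a : (arity c).-tuple Bciw) : Ci_rhs_in a !=set0.
Proof.
have first (x : A) : exists u : Bciw, c1 (val u) = x.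
  have h : Bciw (x, ~` x, \top)%O.
    by rewrite /Bciw /c1 /c2 /c3 /= joinxC meetxC compl0.
  by exists (SigSub (mem_set h)).
case: c a => a; rewrite /Ci_rhs_in /=; try exact: first.
- have [z1 z2] : Bciw (val (tnth a ord0)) by apply/set_mem/valP.
  set z := val _ in z1 z2.
  have h : Bciw (c2 z, c1 z, c3 z).
    split; first by rewrite -z1; exact: joinC.
    by rewrite [LHS]z2; congr (~` _)%O; exact: meetC.
  by exists (SigSub (mem_set h)); rewrite /= tnth_map.
- set t := (_ `&` _)%O.
  have h : Bciw (~` t, t, \top)%O.
    by rewrite /Bciw /c1 /c2 /c3 /= joinC joinxC meetC meetxC compl0.
  by exists (SigSub (mem_set h)).
Qed.

Definition full_swap_Ci : multialgebra Bciw :=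
  Multialgebra full_dom_nonempty full_op_nonempty.

Fact full_swap_CiP : is_swap_Ci full_swap_Ci.
Proof.
split => //; last by move=> c a _.
by exists (\bot, \top, \top)%O => //; exact: Bciw_bot.
Qed.
End Swap.

Arguments Bciw {d} A.
Arguments full_swap_Ci {d} A.

(* Main.v *)
(** A proper filter of a Boolean algebra that is maximal for inclusion is an
    ultrafilter, i.e. the preimage of [true] under a Boolean homomorphism to the
    two-element algebra; by Zorn's lemma every nonzero element lies in one, so
    these homomorphisms separate points.  Applying all of them coordinatewise to
    the triples of [D] gives an injective homomorphism to the power of the full
    swap structure over [bool] indexed by the homomorphisms themselves, because
    the conditions on the multioperations are Boolean equations and
    inequalities. *)
Require Import Defs.
From mathcomp Require Import all_boot all_order.
From mathcomp Require Import boolp classical_sets.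

Set Implicit Arguments.
Unset Strict Implicit.
Unset Printing Implicit Defensive.

Import Order.Theory.

Local Open Scope classical_set_scope.

Lemma inj_is_mono (T U : Type) (A : multialgebra T) (B : multialgebra U)
    (f : T -> U) : is_hom A B f -> injective f -> is_mono A B f.
Proof.
move=> f_hom f_inj; split=> // V C g1 g2 _ _ fg; apply/funext => v.
exact/f_inj/(congr1 (@^~ v) fg).
Qed.

Section BooleanHom.
Context {d : Order.disp_t} {A : ctbDistrLatticeType d}.
Implicit Types (x y : A).

(** Meet and complement generate the Boolean operations, so preservation of joins, bounds and order
    follows from these two laws. *)
Record bool_hom := BoolHom {
  bool_hom_fun :> A -> bool;
  bool_homI : forall x y,
    bool_hom_fun (x `&` y)%O = bool_hom_fun x && bool_hom_fun y;
  bool_homC : forall x, bool_hom_fun (~` x)%O = ~~ bool_hom_fun x }.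

Lemma bool_homU (f : bool_hom) x y : f (x `|` y)%O = f x || f y.
Proof.
rewrite -[(x `|` y)%O]complK complU bool_homC bool_homI !bool_homC.
by rewrite negb_and !negbK.
Qed.

Lemma bool_hom0 (f : bool_hom) : f \bot%O = false.
Proof. by rewrite -(meetxC (\bot%O : A)) bool_homI bool_homC andbN. Qed.

Lemma bool_hom1 (f : bool_hom) : f \top%O = true.
Proof. by rewrite -compl0 bool_homC bool_hom0. Qed.

Lemma bool_hom_le (f : bool_hom) x y : (x <= y)%O -> (f x <= f y)%O.
Proof. by move=> /meet_idPl xy; rewrite -xy bool_homI; case: (f x). Qed.

(* The membership of [a] is only required of nonempty sets: Zorn's lemma
   [Zorn_bigcup] also asks for the union of the empty chain. *)
Let proper_filter_at (a : A) (X : set A) :=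
  [/\ forall x y, X x -> (x <= y)%O -> X y,
      forall x y, X x -> X y -> X (x `&` y)%O,
      ~ X \bot%O
    & X !=set0 -> X a].

Lemma bool_hom_exists (a : A) : a != \bot%O -> exists f : bool_hom, f a.
Proof.
move=> a0.
have [M [[Mup Mmeet M0 Ma] Mmax]] : exists M, proper_filter_at a M /\
    forall X, M `<` X -> ~ proper_filter_at a X.
  apply: Zorn_bigcup => F FP Ftot; split.
  - move=> x y [X FX Xx] xy; exists X => //; have [up _ _ _] := FP _ FX.
    exact: up xy.
  - move=> x y [X FX Xx] [Y FY Yy]; have [_ mX _ _] := FP _ FX.
    have [_ mY _ _] := FP _ FY; have [XY|YX] := Ftot _ _ FX FY.
      by exists Y => //; apply: mY => //; exact: XY.
    by exists X => //; apply: mX => //; exact: YX.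
  - by move=> [X FX X0]; have [_ _ + _] := FP _ FX; exact.
  - move=> [x [X FX Xx]]; exists X => //; have [_ _ _ +] := FP _ FX; apply.
    by exists x.
(* The empty set satisfies [proper_filter_at a], so [M] could a priori be empty. In that case the
   principal filter of [a], proper because [a] is nonzero, would strictly extend it. *)
have {}Ma : M a.
  apply: contrapT => nMa.
  apply: (Mmax [set y | (a <= y)%O]).
    split; last by move=> sub; apply/nMa/sub => /=.
    by move=> x Mx; case: nMa; apply: Ma; exists x.
  split=> /=.
  - by move=> x y; exact: le_trans.
  - by move=> x y; rewrite lexI => -> ->.
  - by rewrite lex0; exact/negP.
  - by [].
have MCx_of_nMx x : ~ M x -> M (~` x)%O.
  move=> nMx; apply: contrapT => nMCx.
  (* This is the filter generated by [M] and [x]. It is proper: [m] meeting [x] in bottom means that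
     [m] lies below the complement of [x], which would then belong to [M]. *)
  apply: (Mmax [set y | exists2 m, M m & (m `&` x <= y)%O]).
    split; first by move=> y My; exists y => //; exact: leIl.
    by move=> sub; apply/nMx/sub; exists a => //; exact: leIr.
  split.
  - by move=> y z [m Mm my] yz; exists m => //; exact: le_trans yz.
  - move=> y z [m Mm my] [n Mn nz]; exists (m `&` n)%O; first exact: Mmeet.
    by rewrite lexI (le_trans _ my) ?(le_trans _ nz) // leI2 // ?leIl ?leIr.
  - move=> [m Mm]; rewrite lex0 => /eqP mx0; apply/nMCx/(Mup m) => //.
    by rewrite -disj_leC mx0.
  - by move=> _; exists a => //; exact: leIl.
have MI x y : `[< M (x `&` y)%O >] = `[< M x >] && `[< M y >].
  apply/asboolP/andP => [Mxy|[/asboolP Mx /asboolP My]]; last exact: Mmeet.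
  by split; apply/asboolP; apply: (Mup _ _ Mxy); [exact: leIl|exact: leIr].
have MC x : `[< M (~` x)%O >] = ~~ `[< M x >].
  apply/asboolP/asboolPn => [MCx Mx|]; last exact: MCx_of_nMx.
  by apply: M0; rewrite -(meetxC x); exact: Mmeet.
by exists (BoolHom MI MC); exact/asboolP.
Qed.

(** In the one-element algebra no [f] exists and the premise is vacuous, but any two elements are
    then equal anyway. *)
Lemma bool_hom_separates x y : (forall f : bool_hom, f x = f y) -> x = y.
Proof.
(* If [u] is not below [v], then [u] meets the complement of [v] in a nonzero element; a
   homomorphism true there sends [u] to true and [v] to false. *)
have le_of (u v : A) : (forall f : bool_hom, f u = f v) -> (u <= v)%O.
  move=> fuv; rewrite -[v]complK -disj_leC; apply: contrapT => /negP.
  by move=> /bool_hom_exists[f]; rewrite bool_homI bool_homC fuv andbN.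
by move=> fxy; apply: le_anti; rewrite !le_of.
Qed.

Definition map_triple (f : A -> bool) (z : A * A * A) : bool * bool * bool :=
  (f (c1 z), f (c2 z), f (c3 z)).

Lemma map_triple_Bciw (f : bool_hom) z : Bciw A z -> Bciw bool (map_triple f z).
Proof.
case: z => [[z1 z2] z3] [/= z12 z3E]; split; rewrite /c1 /c2 /c3 /=.
  by rewrite -[LHS]bool_homU z12 bool_hom1.
by rewrite -[RHS]/(~~ (f z1 && f z2)) -bool_homI -bool_homC; congr (f _).
Qed.

Lemma map_triple_Ci_rhs (f : bool_hom) c (a : (arity c).-tuple (A * A * A)) u :
  Ci_rhs a u -> Ci_rhs (map_tuple (map_triple f) a) (map_triple f u).
Proof.
case: c a => a; rewrite /= !tnth_map /map_triple /bimp /c1 /c2 /c3 /=.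
- by move=> ->; exact: bool_homI.
- by move=> ->; exact: bool_homU.
- by move=> ->; rewrite bool_homU bool_homC.
- by move=> [-> le_u]; split=> //; exact: bool_hom_le.
- by move=> ->; rewrite /= bool_homC bool_homI bool_hom1.
Qed.

End BooleanHom.

Arguments bool_hom {d} A.

Theorem theorem8p22 (d : Order.disp_t) (A : ctbDistrLatticeType d)
    (D : set (A * A * A)) (B : multialgebra D) (hB : is_swap_Ci B) :
  exists (I : Type) (h : D -> (I -> Bciw bool)),
    is_mono B (prod_malg (fun _ : I => full_swap_Ci bool)) h.
Proof.
have [DB _ Bop Bcirc] := hB.
have Brhs c (a : (arity c).-tuple D) : B c a `<=` Ci_rhs_in a.
  by have [Ec|/Bop] := pselect (c = Circ); last exact; subst c; rewrite Bcirc.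
have hD (z : D) (f : bool_hom A) : Bciw bool (map_triple f (val z)).
  exact/map_triple_Bciw/DB/set_mem/valP.
pose h (z : D) (f : bool_hom A) : Bciw bool := SigSub (mem_set (hD z f)).
exists (bool_hom A), h; apply: inj_is_mono.
  (* Membership in a product operation is checked at each index [f], where the target's operation is
     the whole of [Ci_rhs_in]. *)
  move=> c a _ [u /Brhs/= Bu <-] f.
  have := map_triple_Ci_rhs f Bu; rewrite /= /Ci_rhs_in /=.
  congr (Ci_rhs _ _); apply: eq_from_tnth => i.
  by rewrite !tnth_map.
move=> z w hzw; apply: val_inj.
have E (f : bool_hom A) : map_triple f (val z) = map_triple f (val w).
  exact: (congr1 (fun g : bool_hom A -> Bciw bool => val (g f)) hzw).
case: (val z) (val w) E => [[z1 z2] z3] [[w1 w2] w3] E.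
by congr (_, _, _); apply: bool_hom_separates => f; case: (E f).
Qed.
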